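(* Let $n$, $m$, $p$ be integers with $m \geq 2$ and $2 \leq p \leq n$. Let $X \subseteq \mathbb{C}^n$ be the set of all points $(a_1,\ldots,a_n)$ for which there are at least $p$ indices $i_1<\cdots<i_p$ with $a_{i_1}^m = a_{i_2}^m = \cdots = a_{i_p}^m$. Then the ideal of all polynomials in $\mathbb{C}[x_1,\ldots,x_n]$ vanishing on $X$ equals \[\Big\langle \prod_{i \equiv_{\lambda} j,\ i<j} (x_i^m - x_j^m) \;\Big|\; \lambda \text{ a set partition of } [n] \text{ with exactly } p-1 \text{ blocks}\Big\rangle.\]
   Context: $[n]=\{1,\ldots,n\}$. For a set partition $\lambda$ of $[n]$ into disjoint nonempty blocks, $i \equiv_\lambda j$ means that $i$ and $j$ lie in the same block of $\lambda$; the product runs over all pairs $i<j$ in a common block (an empty product equals $1$). *)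

(* Defs.v *)
From HB Require Import structures.
From mathcomp Require Import all_boot all_order all_algebra.
From mathcomp Require Import mpoly.
From mathcomp Require Import complex.
From mathcomp Require Import reals.

Set Implicit Arguments.
Unset Strict Implicit.
Unset Printing Implicit Defensive.

Import GRing.Theory.
Local Open Scope ring_scope.

Section Ideals.
Variables (K : comNzRingType) (n : nat).

Definition vanishing_ideal (X : ('I_n -> K) -> Prop) (f : {mpoly K[n]}) : Prop :=
  forall a : 'I_n -> K, X a -> f.@[a] = 0.

Definition ideal_generated (A : comNzRingType) (G : A -> Prop) (f : A) : Prop :=
  exists s : seq (A * A),
    (forall cg, cg \in s -> G cg.2) /\ f = \sum_(cg <- s) cg.1 * cg.2.

(* 'I_n = {0, ..., n-1} plays the role of [n]. *)
Definition same_block (P : {set {set 'I_n}}) (i j : 'I_n) : bool :=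
  [exists B in P, (i \in B) && (j \in B)].

Definition partition_product (m : nat) (P : {set {set 'I_n}}) : {mpoly K[n]} :=
  \prod_(i < n) \prod_(j < n | (i < j)%N && same_block P i j)
     ('X_i ^+ m - 'X_j ^+ m).

Definition partition_generator (m k : nat) (g : {mpoly K[n]}) : Prop :=
  exists P : {set {set 'I_n}},
    [/\ partition P [set: 'I_n], #|P| = k & g = partition_product m P].

(* A p-element set of indices is the same as an increasing list i_1 < ... < i_p. *)
Definition equal_powers_locus (m p : nat) (a : 'I_n -> K) : Prop :=
  exists I : {set 'I_n},
    #|I| = p /\ {in I &, forall i j, a i ^+ m = a j ^+ m}.

End Ideals.

(* Main.v *)
Require Import Defs.
From HB Require Import structures.
From mathcomp Require Import all_boot all_order all_algebra.
From mathcomp Require Import mpoly.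
From mathcomp Require Import complex.
From mathcomp Require Import reals.
From mathcomp Require Import boolp separable cyclotomic zify ring.

Set Implicit Arguments.
Unset Strict Implicit.
Unset Printing Implicit Defensive.

Import GRing.Theory Num.Theory.
Local Open Scope ring_scope.

(** Points [a] are stratified by the partition formed by the multiplicities of
    the values [a_i ^ m].  We prove a more general statement, by induction on the
    number of variables and then on the degree [d] in the last variable [x]: if
    [D] is closed under dominance, a polynomial vanishing at all points with
    nonzero coordinates and shape outside [D] is a combination of products over
    set partitions with shape in [D].  The leading coefficient in [x] vanishes at
    every point admitting more than [d] values of [x] that lead outside [D]
    (each value of [a_i ^ m] contributes [m] of them, as [a_i] is nonzero), so
    it lies in the span for a smaller dominance-closed family.  Each partition
    occurring there has a block of size at most [d / m]; adding the last index to
    that block lifts the leading coefficient to an element of the span for [D],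
    and subtracting it lowers the degree.  The theorem is the case where [D]
    consists of the shapes with at most [p - 1] blocks. *)

(** * Shapes and dominance *)

Section Shapes.
Local Open Scope nat_scope.
Implicit Types (kap : nat -> nat) (d x t : nat).

Definition is_shape kap :=
  (forall t, kap t.+1 <= kap t) /\ (exists t, kap t = 0).

Definition prefix_sum kap t := \sum_(s < t) kap s.

Definition dominated kap kap' :=
  forall t, prefix_sum kap t <= prefix_sum kap' t.

Definition dominance_closed (D : (nat -> nat) -> Prop) :=
  forall kap kap', is_shape kap -> is_shape kap' -> dominated kap kap' ->
    D kap -> D kap'.

Definition add_box kap x : nat -> nat := fun t => kap t + (t == x).

Definition first_le d kap x := kap x <= d /\ (forall s, s < x -> d < kap s).

(* Read on block sizes: a new element may join the first block of size at
   most [d]. *)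
Definition box_preimage d (D : (nat -> nat) -> Prop) kap :=
  exists x, first_le d kap x /\ D (add_box kap x).

Lemma first_le_exists d kap : is_shape kap -> exists x, first_le d kap x.
Proof.
case=> _ [t kt0].
have ex : exists t, kap t <= d by exists t; rewrite kt0.
exists (ex_minn ex); case: ex_minnP => x kx min_x; split=> // s lt_sx.
by rewrite ltnNge; apply/negP => /min_x; lia.
Qed.

Lemma shape_antitone kap s t : is_shape kap -> s <= t -> kap t <= kap s.
Proof.
move=> [kapS _]; elim: t => [|t IH]; first by case: s.
rewrite leq_eqVlt => /orP[/eqP-> //|le_st].
exact: leq_trans (kapS t) (IH le_st).
Qed.

Lemma prefix_sumS kap t : prefix_sum kap t.+1 = prefix_sum kap t + kap t.
Proof. exact: big_ord_recr. Qed.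

Lemma prefix_sum_add_box kap x t :
  prefix_sum (add_box kap x) t = prefix_sum kap t + (x < t).
Proof.
elim: t => [|t IH]; first by rewrite /prefix_sum !big_ord0.
rewrite !prefix_sumS IH /add_box addnACA ltnS (eq_sym t x).
by congr (_ + _); case: ltngtP.
Qed.

(** Rows before [x] exceed [d], hence are strictly longer than row [x], so one more box there keeps
    the rows weakly decreasing. *)
Lemma shape_add_box d kap x : is_shape kap -> first_le d kap x ->
  is_shape (add_box kap x).
Proof.
move=> sh [kx lt_x]; have [kapS [t kt0]] := sh; split=> [s|].
  have := kapS s; have := lt_x s; rewrite /add_box => lt_s.
  have [def_x|_] := eqVneq s.+1 x; last by lia.
  by move: kx lt_s; rewrite -def_x; lia.
exists (maxn t x.+1); have := shape_antitone sh (leq_maxl t x.+1).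
by rewrite kt0 /add_box; lia.
Qed.

Lemma dominated_add_box kap x y : x <= y ->
  dominated (add_box kap y) (add_box kap x).
Proof. by move=> le_xy t; rewrite !prefix_sum_add_box; lia. Qed.

(** Only prefixes with [x < t <= x'] are at risk, where the left side alone has gained its box. On
    rows from [x] up to [x'], [kap] is at most [d] while [kap'] exceeds [d], so [kap'] gains at
    least one per row, which pays for the box. *)
Lemma dominated_add_first_box d kap kap' x x' : is_shape kap ->
  dominated kap kap' -> first_le d kap x -> first_le d kap' x' ->
  dominated (add_box kap x) (add_box kap' x').
Proof.
move=> sh dom [kx lt_x] [kx' lt_x'] t; rewrite !prefix_sum_add_box.
have strict j : x + j <= x' ->
    prefix_sum kap (x + j) + j <= prefix_sum kap' (x + j).
  elim: j => [|j IH] le_j; first by rewrite !addn0; exact: dom.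
  have := IH ltac:(lia); rewrite (addnS x) !prefix_sumS.
  have := lt_x' (x + j) ltac:(lia).
  have := shape_antitone sh (leq_addr j x); lia.
have := dom t; have [lt_xt|] := ltnP x t; last lia.
by have := strict (t - x); rewrite subnKC; lia.
Qed.

(** This lets the induction on the number of variables pass from [D] to [box_preimage d D]. *)
Lemma dominance_closed_box_preimage d D :
  dominance_closed D -> dominance_closed (box_preimage d D).
Proof.
move=> clD kap kap' sh sh' dom [x [fx Dx]].
have [x' fx'] := first_le_exists d sh'; exists x'; split=> //.
apply: clD Dx; [exact: shape_add_box fx|exact: shape_add_box fx'|].
exact: dominated_add_first_box fx fx'.
Qed.

End Shapes.

(** * Colour counts and ranks *)

Section Ranks.
Local Open Scope nat_scope.

Definition color_count k (c : nat -> nat) t := \sum_(i < k) (c i == t).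

(* For a point [b], the number of indices of rank [t] is the number of values
   taken more than [t] times, so [color_count k (rank b)] is the conjugate of
   the partition formed by the multiplicities. *)
Definition rank (T : eqType) (b : nat -> T) i := \sum_(j < i) (b j == b i).

Lemma color_countS k c :
  color_count k.+1 c = add_box (color_count k c) (c k).
Proof. by apply/funext => t; rewrite /color_count big_ord_recr /= /add_box eq_sym. Qed.

Lemma eq_color_count k c c' : (forall i, i < k -> c i = c' i) ->
  color_count k c = color_count k c'.
Proof. by move=> e; apply/funext => t; apply: eq_bigr => i _; rewrite e. Qed.

Lemma sum_bool_card k (P : pred nat) :
  \sum_(i < k) P i = #|[set i : 'I_k | P i]|.
Proof.
rewrite -sum1_card [RHS]big_mkcond; apply: eq_bigr => i _.
by rewrite inE; case: (P i).
Qed.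

Lemma color_countE k c t : color_count k c t = #|[set i : 'I_k | c i == t]|.
Proof. exact: (sum_bool_card k (fun i => c i == t)). Qed.

Variable T : eqType.
Implicit Type b : nat -> T.

Lemma eq_rank b b' i : (forall j, j <= i -> b j = b' j) -> rank b i = rank b' i.
Proof. by move=> e; apply: eq_bigr => j _; rewrite !e // ltnW. Qed.

Lemma ltn_sum_bool (P : pred nat) i j : i < j -> P i ->
  \sum_(l < i) P l < \sum_(l < j) P l.
Proof.
move=> lt_ij Pi.
rewrite -!(big_mkord xpredT (fun l => P l : nat)).
by rewrite (big_cat_nat (leq0n i.+1) lt_ij) /= big_nat_recr //= Pi; lia.
Qed.

Lemma sum_bool_inj (P : pred nat) i j : P i -> P j ->
  \sum_(l < i) P l = \sum_(l < j) P l -> i = j.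
Proof.
move=> Pi Pj e; case: (ltngtP i j) => // lt.
  by have := ltn_sum_bool lt Pi; rewrite e ltnn.
by have := ltn_sum_bool lt Pj; rewrite e ltnn.
Qed.

Lemma rank_inj b i j : b i = b j -> rank b i = rank b j -> i = j.
Proof.
rewrite /rank => eb; rewrite eb => er.
by apply: (@sum_bool_inj (fun l => b l == b j)) er; rewrite /= ?eb.
Qed.

Lemma rank_prev b i t : rank b i = t.+1 ->
  exists j, [/\ j < i, b j = b i & rank b j = t].
Proof.
rewrite /rank; move: (b i) => v.
elim: i => [|i IH]; first by rewrite big_ord0.
rewrite big_ord_recr /=; have [bi|_] := eqVneq (b i) v.
  by rewrite addn1 => -[<-]; exists i; rewrite bi.
by rewrite addn0 => /IH[j [lt_ji bj rj]]; exists j; rewrite ltnS ltnW.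
Qed.

Lemma rank_below b i r : r <= rank b i ->
  exists j, [/\ j <= i, b j = b i & rank b j = r].
Proof.
move: {2}(rank b i - r) (erefl (rank b i - r)) => e.
elim: e i => [|e IH] i De le_r; first by exists i; split=> //; lia.
have [j [lt_ji bj rj]] := @rank_prev b i (rank b i).-1 ltac:(lia).
have [||l [le_lj bl rl]] := IH j; [lia|lia|].
by exists l; rewrite bl rl; split=> //; lia.
Qed.

Lemma rank_le b i : rank b i <= i.
Proof.
rewrite /rank -[X in _ <= X]card_ord -sum1_card.
by apply: leq_sum => j _; case: eqP.
Qed.

(** Sending an index of rank [t.+1] to the one of rank [t] with the same value is injective, so the
    counts decrease with [t]. *)
Lemma shape_rank k b : is_shape (color_count k (rank b)).
Proof.
split=> [t|]; last first.
  exists k; rewrite /color_count big1 // => i _.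
  by have := rank_le b i; have := ltn_ord i; case: eqP; lia.
rewrite !color_countE.
pose prev (i : 'I_k) := odflt i [pick j : 'I_k | (b j == b i) && (rank b j == t)].
have prevP (i : 'I_k) : rank b i == t.+1 -> b (prev i) = b i /\ rank b (prev i) = t.
  move=> /eqP/rank_prev[j [lt_ji bj rj]]; rewrite /prev.
  case: pickP => [l /andP[/eqP ? /eqP ?] //|].
  by move/(_ (Ordinal (ltn_trans lt_ji (ltn_ord i)))); rewrite /= bj rj !eqxx.
rewrite -(@card_in_imset _ _ prev) => [|i j]; last first.
  rewrite !inE => ri rj e; apply: val_inj; apply: (@rank_inj b).
    by rewrite -(prevP _ ri).1 e (prevP _ rj).1.
  by rewrite (eqP ri) (eqP rj).
by apply/subset_leq_card/subsetP => _ /imsetP[i /[!inE] ri ->];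
  rewrite (prevP _ ri).2.
Qed.

Lemma prefix_sum_color_count k c t :
  prefix_sum (color_count k c) t = #|[set i : 'I_k | c i < t]|.
Proof.
elim: t => [|t IH].
  by rewrite /prefix_sum big_ord0; apply/esym/eqP; rewrite cards_eq0;
    apply/eqP/setP => i; rewrite !inE.
rewrite prefix_sumS IH color_countE -cardsUI addnC (_ : _ :&: _ = set0).
  by rewrite cards0; apply: eq_card => i; rewrite !inE; lia.
by apply/setP => i; rewrite !inE; lia.
Qed.

(* In a fibre of [b], the colours below [t] number at most [t], and so do the
   ranks below [t], which are as many as possible. *)
Lemma color_count_dominated_rank k b c :
  (forall i j, i < k -> j < k -> c i = c j -> b i = b j -> i = j) ->
  dominated (color_count k c) (color_count k (rank b)).
Proof.
move=> c_inj t; rewrite !prefix_sum_color_count.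
(* [r i] counts the indices before [i] in its fibre whose colour is below [t]. *)
pose P i j := (b j == b i) && (c j < t).
pose r i := \sum_(j < i) P i j.
have r_lt (i : 'I_k) : c i < t -> r i < t.
  move=> lt_ci; have Pii : P i i by rewrite /P eqxx.
  apply: leq_trans (ltn_sum_bool (ltnSn i) Pii) _.
  (* Colours are distinct within a fibre, so [c] embeds the counted indices, [i] included, into the
     [t] colours below [t]. Making [t] a successor allows [inord]. *)
  case: t @P @r lt_ci Pii => // t P _ lt_ci Pii.
  rewrite sum_bool_card -(@card_in_imset _ 'I_t.+1 (fun l : 'I_i.+1 => inord (c l))).
    by apply: leq_trans (max_card _) _; rewrite card_ord.
  move=> l1 l2; rewrite !inE => /andP[/eqP b1 c1] /andP[/eqP b2 c2].
  move/(congr1 val); rewrite /= !inordK // => e; apply/val_inj/c_inj => //=.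
  - by have := ltn_ord l1; have := ltn_ord i; lia.
  - by have := ltn_ord l2; have := ltn_ord i; lia.
  - by rewrite b1 b2.
(* [h] packs the indices of colour below [t] onto the lowest ranks of their fibre; by [hP] the
   default [i] is never taken. *)
pose h (i : 'I_k) := odflt i [pick j : 'I_k | (b j == b i) && (rank b j == r i)].
have hP i : b (h i) = b i /\ rank b (h i) = r i.
  have le_r : r i <= rank b i by apply: leq_sum => l _; rewrite /P; lia.
  have [j [le_ji bj rj]] := rank_below le_r; rewrite /h.
  case: pickP => [l /andP[/eqP ? /eqP ?] //|].
  by move/(_ (Ordinal (leq_ltn_trans le_ji (ltn_ord i)))); rewrite /= bj rj !eqxx.
rewrite -(@card_in_imset _ _ h) => [|i j]; last first.
  rewrite !inE => ci cj e; apply: val_inj.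
  have bij : b i = b j by rewrite -(hP i).1 e (hP j).1.
  have rij : r i = r j by rewrite -(hP i).2 e (hP j).2.
  apply: (@sum_bool_inj (P i)); rewrite /P ?bij ?eqxx //.
  by rewrite -/(P j) -/(r j) -rij /r; apply: eq_bigr => l _; rewrite /P bij.
by apply/subset_leq_card/subsetP => _ /imsetP[i /[!inE] ci ->];
  rewrite (hP i).2; exact: r_lt.
Qed.

End Ranks.

(** * Polynomials in the first variables *)

Section FirstVariables.
Variables (K : numClosedFieldType) (N : nat).
Let A : idomainType := {mpoly K[N.+1]}.
Implicit Types (a : nat -> K) (f g : A) (q : {poly A}).

(** Natural indices let the number of variables vary inside one ring; past [N], [inord] falls back
    to index 0, hence the bounds below. *)
Definition var i : A := 'X_(inord i).

Definition ev a f : K := f.@[fun i : 'I_N.+1 => a i].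

HB.instance Definition _ a := GRing.RMorphism.copy (ev a)
  (meval (fun i : 'I_N.+1 => a i)).

Lemma ev_var a i : (i <= N)%N -> ev a (var i) = a i.
Proof. by move=> le_iN; rewrite /ev /var mevalXU inordK. Qed.

(** The recursive form directly supplies a polynomial in the last variable with coefficients in the
    earlier ones. *)
Fixpoint in_vars k f : Prop :=
  if k is k'.+1 then
    exists q : {poly A}, (forall i, in_vars k' q`_i) /\ f = q.[var k']
  else exists c : K, f = c%:MP.

Definition coefs_in_vars k q := forall i, in_vars k q`_i.

Lemma in_varsC k c : in_vars k c%:MP.
Proof.
elim: k c => [|k IH] c /=; first by exists c.
exists (c%:MP)%:P; rewrite hornerC; split=> // i.
by rewrite coefC; case: eqP => _; [exact: IH|rewrite -mpolyC0; exact: IH].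
Qed.

Lemma in_vars0 k : in_vars k 0.
Proof. by rewrite -mpolyC0; exact: in_varsC. Qed.

Lemma in_varsW k f : in_vars k f -> in_vars k.+1 f.
Proof.
move=> fk; exists f%:P; rewrite hornerC; split=> // i.
by rewrite coefC; case: eqP => _ //; exact: in_vars0.
Qed.

Lemma in_varsD k f g : in_vars k f -> in_vars k g -> in_vars k (f + g).
Proof.
elim: k f g => [|k IH] f g /= [q1 D1] [q2 D2].
  by exists (q1 + q2); rewrite D1 D2 mpolyCD.
exists (q1 + q2); rewrite D1.2 D2.2 hornerD; split=> // i.
by rewrite coefD; apply: IH; [exact: D1.1|exact: D2.1].
Qed.

Lemma in_vars_sum k I (r : seq I) (P : pred I) (F : I -> A) :
  (forall i, P i -> in_vars k (F i)) -> in_vars k (\sum_(i <- r | P i) F i).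
Proof.
move=> FP; elim/big_ind: _ => //; [exact: in_vars0|exact: in_varsD].
Qed.

Lemma in_varsM k f g : in_vars k f -> in_vars k g -> in_vars k (f * g).
Proof.
elim: k f g => [|k IH] f g /= [q1 D1] [q2 D2].
  by exists (q1 * q2); rewrite D1 D2 mpolyCM.
exists (q1 * q2); rewrite D1.2 D2.2 hornerM; split=> // i.
by rewrite coefM; apply: in_vars_sum => j _; apply: IH; [exact: D1.1|exact: D2.1].
Qed.

Lemma in_vars1 k : in_vars k 1.
Proof. exact: in_varsC. Qed.

Lemma in_varsN k f : in_vars k f -> in_vars k (- f).
Proof.
move=> fk; rewrite -mulN1r -mpolyC1 -mpolyCN.
by apply: in_varsM => //; exact: in_varsC.
Qed.

Lemma in_vars_prod k I (r : seq I) (P : pred I) (F : I -> A) :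
  (forall i, P i -> in_vars k (F i)) -> in_vars k (\prod_(i <- r | P i) F i).
Proof.
move=> FP; elim/big_ind: _ => //; [exact: in_vars1|exact: in_varsM].
Qed.

Lemma in_varsXn k f n : in_vars k f -> in_vars k (f ^+ n).
Proof.
move=> fk; elim: n => [|n IH]; first exact: in_vars1.
by rewrite exprS; exact: in_varsM.
Qed.

Lemma in_vars_var k i : (i < k)%N -> in_vars k (var i).
Proof.
elim: k => // k IH; rewrite ltnS leq_eqVlt => /orP[/eqP->|/IH]; last first.
  exact: in_varsW.
exists 'X; rewrite hornerX; split=> // j; rewrite coefX.
by case: eqP => _; [exact: in_vars1|exact: in_vars0].
Qed.

Lemma in_vars_full f : in_vars N.+1 f.
Proof.
rewrite (mpolyE f); apply: in_vars_sum => mm _.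
rewrite -mul_mpolyC; apply: in_varsM; first exact: in_varsC.
rewrite mpolyXE_id; apply: in_vars_prod => i _; apply: in_varsXn.
by rewrite -(inord_val i); exact: in_vars_var.
Qed.

Lemma coefs_in_varsC k f : in_vars k f -> coefs_in_vars k f%:P.
Proof. by move=> fk i; rewrite coefC; case: eqP => _ //; exact: in_vars0. Qed.

Lemma coefs_in_varsXn k n : coefs_in_vars k 'X^n.
Proof.
by move=> i; rewrite coefXn; case: eqP => _; [exact: in_vars1|exact: in_vars0].
Qed.

Lemma coefs_in_varsD k q1 q2 :
  coefs_in_vars k q1 -> coefs_in_vars k q2 -> coefs_in_vars k (q1 + q2).
Proof. by move=> h1 h2 i; rewrite coefD; exact: in_varsD. Qed.

Lemma coefs_in_varsN k q : coefs_in_vars k q -> coefs_in_vars k (- q).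
Proof. by move=> h i; rewrite coefN; exact: in_varsN. Qed.

Lemma coefs_in_varsM k q1 q2 :
  coefs_in_vars k q1 -> coefs_in_vars k q2 -> coefs_in_vars k (q1 * q2).
Proof.
by move=> h1 h2 i; rewrite coefM; apply: in_vars_sum => j _; exact: in_varsM.
Qed.

Lemma ev_horner a q k : (k <= N)%N ->
  ev a q.[var k] = (map_poly (ev a) q).[a k].
Proof. by move=> le_kN; rewrite -(ev_var a le_kN) horner_map. Qed.

Lemma eq_ev_in_vars k a a' f : (k <= N.+1)%N ->
  (forall i, (i < k)%N -> a i = a' i) -> in_vars k f -> ev a f = ev a' f.
Proof.
elim: k f => [|k IH] f le_kN e /= [q]; first by move->; rewrite /ev !mevalC.
case=> qk ->; rewrite !ev_horner // e //; congr (_.[_]).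
apply/polyP => i; rewrite !coef_map /=; apply: IH => //; first exact: ltnW.
by move=> j lt_jk; apply: e; exact: ltnW.
Qed.

End FirstVariables.

(** * The vanishing theorem for dominance-closed loci *)

Lemma unity_roots_list (K : numClosedFieldType) m : (0 < m)%N ->
  exists Z : seq K, [/\ uniq Z, size Z = m & forall z, z \in Z -> z ^+ m = 1].
Proof.
move=> m_gt0; pose p : {poly K} := 'X^m - 1.
have [Z Dp] := closed_field_poly_normal p.
rewrite (monicP _) ?monicXnsubC // scale1r in Dp.
exists Z; split.
- by rewrite -separable_prod_XsubC -Dp separable_Xn_sub_1 // pnatr_eq0 -lt0n.
- by apply: succn_inj; rewrite -(size_prod_XsubC Z id) -Dp size_XnsubC.
- move=> z; rewrite -root_prod_XsubC -Dp rootE !hornerE.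
  by rewrite subr_eq0 => /eqP.
Qed.

Lemma prod_XnsubC_monic_size (A : idomainType) m k (P : pred nat) (e : nat -> A) :
  (0 < m)%N ->
  let h := \prod_(i < k | P i) ('X^m - (e i)%:P) in
  h \is monic /\ size h = (m * \sum_(i < k) P i).+1.
Proof.
move=> m_gt0; split.
  by apply: rpred_prod => i _; rewrite monicXnsubC.
rewrite big_mkcond /=; elim: k => [|k IH].
  by rewrite !big_ord0 size_poly1 muln0.
rewrite !big_ord_recr /=; case: (P k); last by rewrite mulr1 addn0.
rewrite size_Mmonic ?monicXnsubC ?size_XnsubC ?IH //; first by lia.
by rewrite -size_poly_eq0 IH.
Qed.

Section Vanishing.
Variables (K : numClosedFieldType) (N m : nat).
Hypothesis m_gt0 : (0 < m)%N.
Let A : idomainType := {mpoly K[N.+1]}.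
Notation x := (@var K N).
Implicit Types (a : nat -> K) (c : nat -> nat) (f g u : A) (q : {poly A}).

Definition color_product k c : A :=
  \prod_(j < k) \prod_(i < j | c i == c j) (x i ^+ m - x j ^+ m).

Definition point_shape k a := color_count k (rank (fun i => a i ^+ m)).

(** Requiring [is_shape] numbers the colour classes by weakly decreasing size, so that their counts
    can be compared by dominance. *)
Inductive color_span k (D : (nat -> nat) -> Prop) : A -> Prop :=
| color_span0 : color_span k D 0
| color_spanS u c f : in_vars k u -> is_shape (color_count k c) ->
    D (color_count k c) -> color_span k D f ->
    color_span k D (u * color_product k c + f).

Lemma color_spanD k D f g :
  color_span k D f -> color_span k D g -> color_span k D (f + g).
Proof.
move=> Jf Jg; elim: Jf => [|u c f0 uk sh Dc _ IH]; first by rewrite add0r.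
by rewrite -addrA; apply: color_spanS.
Qed.

Lemma eq_color_product k c c' : (forall i, (i < k)%N -> c i = c' i) ->
  color_product k c = color_product k c'.
Proof.
move=> e; apply: eq_bigr => j _; apply: eq_bigl => i.
by rewrite !e //; exact: ltn_trans (ltn_ord j).
Qed.

Lemma in_vars_color_product k c : in_vars k (color_product k c).
Proof.
apply: in_vars_prod => j _; apply: in_vars_prod => i _; apply: in_varsD.
  by apply/in_varsXn/in_vars_var; exact: ltn_trans (ltn_ord j).
by apply/in_varsN/in_varsXn/in_vars_var.
Qed.

(* An element of the span in the first [k] variables becomes the coefficient of
   degree [d] in variable [k] by putting [k] into a block of size at most
   [d %/ m]. *)
Lemma color_span_lift k D d g : color_span k (box_preimage (d %/ m) D) g ->
  exists q, [/\ coefs_in_vars k q, (size q <= d.+1)%N, q`_d = g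
    & color_span k.+1 D q.[x k]].
Proof.
elim=> [|u c f uk sh [y [fy Dy]] _ [q [qk sq qd Jq]]].
  exists 0; rewrite size_poly0 coef0 horner0.
  by split=> // [i|]; [rewrite coef0; exact: in_vars0|exact: color_span0].
pose s := color_count k c y.
pose c' i := if i == k then y else c i.
have c'E i : (i < k)%N -> c' i = c i by rewrite /c'; case: eqP => // ->; lia.
have c'k : c' k = y by rewrite /c' eqxx.
have le_ms : (m * s <= d)%N.
  by rewrite mulnC -leq_divRL //; case: fy.
pose h : {poly A} := \prod_(i < k | c i == y) ('X^m - (x i ^+ m)%:P).
have [h_mon sz_h] : h \is monic /\ size h = (m * s).+1.
  exact: (@prod_XnsubC_monic_size A m k (fun i => c i == y) (fun i => x i ^+ m)).
(* [h] has degree [m * s], at most [d]; the power of ['X] pads it to a monic polynomial of degree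
   exactly [d]. *)
pose H := 'X^(d - m * s) * h.
have H_mon : H \is monic by rewrite monicMl ?monicXn.
have sz_H : size H = d.+1.
  rewrite size_Mmonic ?monic_neq0 ?monicXn // size_polyXn sz_h; lia.
have Hd : H`_d = 1 by have := monicP H_mon; rewrite lead_coefE sz_H.
have hk : coefs_in_vars k h.
  rewrite /h; elim/big_ind: _ => [||i _].
  - exact: coefs_in_varsXn 0%N.
  - exact: coefs_in_varsM.
  - apply: coefs_in_varsD; first exact: coefs_in_varsXn.
    by apply/coefs_in_varsN/coefs_in_varsC/in_varsXn/in_vars_var.
exists ((u * color_product k c)%:P * H + q); split.
- apply: coefs_in_varsD => //; apply: coefs_in_varsM.
    by apply/coefs_in_varsC/in_varsM => //; exact: in_vars_color_product.
  by apply: coefs_in_varsM => //; exact: coefs_in_varsXn.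
- apply: leq_trans (size_polyD _ _) _; rewrite geq_max sq andbT mul_polyC.
  by apply: leq_trans (size_scale_leq _ _) _; rewrite sz_H.
- by rewrite coefD coefCM Hd mulr1 qd.
have -> : ((u * color_product k c)%:P * H + q).[x k] =
   (u * (-1) ^+ s * x k ^+ (d - m * s)) * color_product k.+1 c' + q.[x k].
  rewrite hornerD !hornerM hornerC hornerXn; congr (_ + _).
  rewrite {2}/color_product big_ord_recr /=.
  rewrite -/(color_product k c') (eq_color_product c'E) c'k.
  rewrite (eq_bigl (fun i : 'I_k => c i == y)) => [|i]; last by rewrite c'E.
  (* The factors of [h] have the opposite sign, one for each of the [s] indices of colour [y]. *)
  have -> : \prod_(i < k | c i == y) (x i ^+ m - x k ^+ m) = (-1) ^+ s * h.[x k].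
    rewrite horner_prod /s color_countE -prodr_const.
    rewrite [X in X * _](eq_bigl (fun i : 'I_k => c i == y)) => [|i]; last first.
      by rewrite inE.
    rewrite -big_split /=.
    by apply: eq_bigr => i _; rewrite !hornerE /=; ring.
  have e1 : ((-1) ^+ s * (-1) ^+ s = 1 :> A) by rewrite -expr2 sqrr_sign.
  rewrite -[LHS]mulr1 -[X in _ * X = _]e1; move: ((-1) ^+ s) => sg; ring.
have c'count : color_count k.+1 c' = add_box (color_count k c) y.
  by rewrite color_countS c'k (eq_color_count c'E).
apply: color_spanS => //.
- apply: in_varsM; first apply: in_varsM.
  + exact: in_varsW.
  + by apply: in_varsXn; apply: in_varsN; exact: in_vars1.
  + by apply/in_varsXn/in_vars_var.
- by rewrite c'count; exact: shape_add_box fy.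
- by rewrite c'count.
Qed.

(** If a colour product is nonzero at [a], indices of equal colour have distinct [m]-th powers. Then
    the colour counts are dominated by the shape of [a], which closure would put in [D]. *)
Lemma color_span_vanishes k D f a : (k <= N.+1)%N -> dominance_closed D ->
  color_span k D f -> ~ D (point_shape k a) -> ev a f = 0.
Proof.
move=> le_kN clD Jf notD; elim: Jf => [|u c g _ sh Dc _ IH]; first exact: rmorph0.
rewrite rmorphD rmorphM /= IH addr0.
suff -> : ev a (color_product k c) = 0 by rewrite mulr0.
apply/eqP/contraT => nz; case: notD.
apply: clD Dc => //; first exact: shape_rank.
have lt_case i j : (i < j)%N -> (j < k)%N -> c i = c j -> a i ^+ m = a j ^+ m ->
    False.
  move=> lt_ij lt_jk cij bij; case/negP: nz.
  rewrite /color_product rmorph_prod /= (bigD1 (Ordinal lt_jk)) //=.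
  rewrite rmorph_prod /= (bigD1 (Ordinal lt_ij)) /= ?cij //.
  by rewrite rmorphB !rmorphXn /= !ev_var ?bij ?subrr ?mul0r //; lia.
apply: color_count_dominated_rank => i j lt_ik lt_jk cij bij.
by case: (ltngtP i j) => // lt; [have := lt_case i j|have := lt_case j i];
  case/(_ lt).
Qed.

(* Any value of [x k] whose [m]-th power already occurs often enough puts the
   extended point on the locus; there are more than [d] such values. *)
Lemma coef_vanishes k D d q a : (k <= N)%N -> dominance_closed D ->
  coefs_in_vars k q -> (size q <= d.+1)%N ->
  (forall a', (forall i, a' i != 0) -> ~ D (point_shape k.+1 a') ->
     ev a' q.[x k] = 0) ->
  (forall i, a i != 0) -> ~ box_preimage (d %/ m) D (point_shape k a) ->
  ev a q`_d = 0.
Proof.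
move=> le_kN clD qk sz_q van a_neq0 notD.
pose b i := a i ^+ m.
have sh : is_shape (point_shape k a) := shape_rank k b.
have [y fy] := first_le_exists (d %/ m) sh.
have notDy : ~ D (add_box (point_shape k a) y) by move=> Dy; case: notD; exists y.
pose Q := map_poly (ev a) q.
suff Q0 : Q = 0 by rewrite -[LHS]coef_map -/Q Q0 coef0.
have rootQ (v : K) : v != 0 -> (y <= \sum_(j < k) (b j == v ^+ m))%N -> root Q v.
  move=> v_neq0 le_y.
  pose a' i := if i == k then v else a i.
  have a'E i : (i < k)%N -> a' i = a i by rewrite /a'; case: eqP => // ->; lia.
  have a'k : a' k = v by rewrite /a' eqxx.
  have a'_neq0 i : a' i != 0 by rewrite /a'; case: (i == k).
  have -> : Q = map_poly (ev a') q.
    apply/polyP => i; rewrite !coef_map /=.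
    by apply: (eq_ev_in_vars (k := k)) => //; [exact: leqW|move=> j /a'E].
  rewrite /root -{1}a'k -ev_horner //; apply/eqP/van => //.
  (* The new index has rank [z], so it adds a box in row [z]. As [y <= z], closure would carry
     membership in [D] over to the shape with the box in row [y]. *)
  set z := (\sum_(j < k) (b j == v ^+ m))%N in le_y.
  have e : point_shape k.+1 a' = add_box (point_shape k a) z.
    rewrite /point_shape color_countS; congr add_box.
      apply: eq_color_count => i lt_ik; apply: eq_rank => j le_ji.
      by rewrite a'E //; exact: leq_ltn_trans lt_ik.
    by rewrite /rank; apply: eq_bigr => j _; rewrite a'E // a'k.
  move=> Dz; apply: notDy; apply: clD Dz.
  - exact: shape_rank.
  - exact: shape_add_box fy.
  - by rewrite e; exact: dominated_add_box.
have sz_Q : (size Q <= d.+1)%N by apply: leq_trans (size_poly _ _) _.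
(* For [y = 0] every nonzero value is a root, in particular the distinct values 1 up to [d.+1]. *)
case: y fy {notDy} rootQ => [|y] [_ lt_y] rootQ.
  apply: (@roots_geq_poly_eq0 _ Q [seq j.+1%:R | j <- iota 0 d.+1]).
  - by apply/allP => _ /mapP[j _ ->]; apply: rootQ; rewrite // pnatr_eq0.
  - by rewrite map_inj_uniq ?iota_uniq // => i j /eqP; rewrite eqr_nat => /eqP[].
  - by rewrite size_map size_iota.
have [Z [uZ szZ Zm]] := unity_roots_list K m_gt0.
have Z_neq0 z : z \in Z -> z != 0.
  move=> zZ; apply/eqP => z0; have := Zm _ zZ.
  by rewrite z0 expr0n gtn_eqF // => /esym/eqP; rewrite oner_eq0.
(* [I] picks one index for each value of [b] taken more than [y] times. There are more than [d %/ m]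
   such values, and each has the [m] roots [a i * z], giving more than [d] roots of [Q]. *)
pose I := enum [set i : 'I_k | rank b i == y].
apply: (@roots_geq_poly_eq0 _ Q [seq a i * z | i : 'I_k <- I, z <- Z]).
- apply/allP => _ /allpairsP[[i z] /= [iI zZ ->]].
  move: iI; rewrite mem_enum inE => /eqP ri.
  apply: rootQ; first by rewrite mulf_neq0 ?a_neq0 ?Z_neq0.
  rewrite exprMn (Zm z) // mulr1 -/(b i) -ri.
  exact: (@ltn_sum_bool (fun l => b l == b i)).
- apply: allpairs_uniq => //; first exact: enum_uniq.
  move=> _ _ /allpairsP[[i z] /= [iI zZ ->]] /allpairsP[[j w] /= [jI wZ ->]] /= e.
  move: iI jI; rewrite !mem_enum !inE => /eqP ri /eqP rj.
  have eij : i = j.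
    apply/val_inj/(@rank_inj _ b); last by rewrite ri rj.
    by have := congr1 (fun t => t ^+ m) e; rewrite !exprMn (Zm z) // (Zm w) // !mulr1.
  by rewrite eij in e *; rewrite (mulfI (a_neq0 j) e).
- apply: leq_trans sz_Q _; rewrite size_allpairs szZ.
  have -> : size I = point_shape k a y.
    by rewrite /point_shape color_countE cardE.
  have := lt_y y (ltnSn y) => lt; apply: leq_trans (leq_mul lt (leqnn m)).
  exact: ltn_ceil.
Qed.

Theorem vanishing_in_color_span k D f : (k <= N.+1)%N -> dominance_closed D ->
  in_vars k f ->
  (forall a, (forall i, a i != 0) -> ~ D (point_shape k a) -> ev a f = 0) ->
  color_span k D f.
Proof.
elim: k D f => [|k IHk] D f le_kN clD.
  case=> e ->{f} van; pose a1 (i : nat) : K := 1.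
  (* Without variables there is a single shape. If it lies in [D], the empty product 1 generates
     every constant; otherwise evaluation at [a1] forces the constant to be 0. *)
  have [D0|notD0] := EM (D (point_shape 0 a1)).
    have -> : (e%:MP : A) = e%:MP * color_product 0 (rank (fun i => a1 i ^+ m)) + 0.
      by rewrite /color_product big_ord0 mulr1 addr0.
    apply: color_spanS => //; [exact: in_varsC|exact: shape_rank|].
    exact: color_span0.
  have := van a1 (fun _ => oner_neq0 _) notD0.
  by rewrite /ev mevalC => ->; rewrite mpolyC0; exact: color_span0.
case=> q [qk ->{f}] van.
have [r] := ubnP (size q); elim: r q qk van => // r IHr q qk van sz_q.
have [->|q_neq0] := eqVneq q 0; first by rewrite horner0; exact: color_span0.
pose d := (size q).-1.
have sz_qd : size q = d.+1 by rewrite /d prednK // lt0n size_poly_eq0.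
have [q' [q'k sz_q' q'd Jq']] : exists q', [/\ coefs_in_vars k q',
    (size q' <= d.+1)%N, q'`_d = q`_d & color_span k.+1 D q'.[x k]].
  apply: color_span_lift; apply: IHk; first exact: ltnW.
  - exact: dominance_closed_box_preimage.
  - exact: qk.
  - by move=> a a0; apply: coef_vanishes => //; rewrite sz_qd.
(* The coefficients of degree [d] cancel in [q - q'], which still vanishes at the required points
   because the span of [D] does. *)
have -> : q.[x k] = (q - q').[x k] + q'.[x k] by rewrite hornerD hornerN subrK.
apply: color_spanD => //; apply: IHr.
- by apply: coefs_in_varsD => //; exact: coefs_in_varsN.
- move=> a a0 notD; rewrite hornerD hornerN rmorphB /= van // sub0r.
  by rewrite (color_span_vanishes le_kN clD Jq' notD) oppr0.
rewrite ltnS in sz_q; apply: leq_trans sz_q; rewrite sz_qd ltnS.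
apply/leq_sizeP => j; rewrite leq_eqVlt => /orP[/eqP<-|lt_dj].
  by rewrite coefB q'd subrr.
by rewrite coefB !nth_default ?subrr // ?sz_qd; exact: leq_trans lt_dj.
Qed.

End Vanishing.

(** * Colourings and set partitions *)

Section Colorings.
Variables (K : numClosedFieldType) (N m : nat).
Let A : comNzRingType := {mpoly K[N.+1]}.

Definition ord_color_product (T : eqType) (c : 'I_N.+1 -> T) : A :=
  \prod_(i < N.+1) \prod_(j < N.+1 | (i < j)%N && (c i == c j))
     ('X_i ^+ m - 'X_j ^+ m).

Lemma color_productE c :
  color_product K N m N.+1 c = ord_color_product (fun i => c i).
Proof.
rewrite /ord_color_product.
under [RHS]eq_bigr do rewrite big_mkcond.
rewrite exchange_big; apply: eq_bigr => j _ /=.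
rewrite (big_ord_widen_cond N.+1 (fun i => c i == c j)
  (fun i => var K N i ^+ m - var K N j ^+ m)); last exact/ltnW.
by rewrite big_mkcond; apply: eq_bigr => i _; rewrite /var !inord_val andbC.
Qed.

(** A finer colouring has fewer monochromatic pairs; the cofactor collects the pairs that [c']
    separates. *)
Lemma ord_color_product_refine (T U : eqType) (c : 'I_N.+1 -> T)
    (c' : 'I_N.+1 -> U) : (forall i j, c' i = c' j -> c i = c j) ->
  exists w, ord_color_product c = w * ord_color_product c'.
Proof.
move=> ref.
exists (\prod_(i < N.+1) \prod_(j < N.+1 | ((i < j)%N && (c i == c j))
  && (c' i != c' j)) ('X_i ^+ m - 'X_j ^+ m)).
rewrite mulrC /ord_color_product -big_split /=.
apply: eq_bigr => i _; rewrite (bigID (fun j => c' i == c' j)) /=.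
congr (_ * _); apply: eq_bigl => j; case: (_ < _)%N => //=.
by case: (c' i =P c' j) => [/ref->|_]; rewrite ?eqxx ?andbF.
Qed.

Lemma refine_surjective r (c : 'I_N.+1 -> 'I_r) : (r <= N.+1)%N ->
  exists c' : 'I_N.+1 -> 'I_r,
    (forall t, exists i, c' i = t) /\ (forall i j, c' i = c' j -> c i = c j).
Proof.
move=> le_r.
have [s] := ubnP (r - #|c @: 'I_N.+1|).
elim: s c => // s IH c lt_s.
have [/forallP surj|/forallPn[t /existsPn ct]] :=
  boolP [forall t, exists i, c i == t].
  by exists c; split=> // t; have /existsP[i /eqP] := surj t; exists i.
have lt_im : (#|c @: 'I_N.+1| < r)%N.
  rewrite -[X in (_ < X)%N]card_ord -cardsT; apply: proper_card.
  apply/properP; split; first exact: subsetT.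
  by exists t => //; apply/imsetP => -[i _ e]; have := ct i; rewrite e eqxx.
have /injectivePn[i [j ne_ij cij]] : ~~ injectiveb c.
  apply/negP => /injectiveP c_inj; move: lt_im.
  by rewrite card_imset // cardT size_enum_ord; lia.
pose c1 l := if l == i then t else c l.
have im1 : c1 @: 'I_N.+1 = t |: (c @: 'I_N.+1).
  apply/setP => u; rewrite !inE; apply/imsetP/orP => [[l _ ->]|].
    rewrite /c1; case: ifP => _; first by left.
    by right; apply/imsetP; exists l.
  case=> [/eqP->|/imsetP[l _ ->]]; first by exists i; rewrite // /c1 eqxx.
  have [->|ne_li] := eqVneq l i.
    by exists j; rewrite // /c1 eq_sym (negPf ne_ij).
  by exists l; rewrite // /c1 (negPf ne_li).
have t_new : t \notin c @: 'I_N.+1.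
  by apply/imsetP => -[l _ e]; have := ct l; rewrite e eqxx.
have [|c' [surj ref]] := IH c1; first by rewrite im1 cardsU1 t_new; lia.
exists c'; split=> // k l /ref; rewrite /c1.
case: (k =P i) => [->|_]; case: (l =P i) => [->|_] // e.
  by have := ct l; rewrite e eqxx.
by have := ct k; rewrite e eqxx.
Qed.

Lemma surjective_color_partition r (c : 'I_N.+1 -> 'I_r) :
  (forall t, exists i, c i = t) ->
  partition_generator m r (ord_color_product c).
Proof.
move=> surj; pose B t := [set i | c i == t].
have B_inj : injective B.
  move=> t u /setP e; have [i ci] := surj t.
  by have := e i; rewrite !inE ci eqxx => /esym/eqP.
have BP t u i : i \in B t -> i \in B u -> t = u.
  by rewrite !inE => /eqP-> /eqP.
exists (B @: 'I_r); split.
- apply/and3P; split.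
  + apply/eqP/setP => i; rewrite inE; apply/bigcupP.
    by exists (B (c i)); [exact: imset_f|rewrite inE].
  + apply/trivIsetP => _ _ /imsetP[t _ ->] /imsetP[u _ ->] ne.
    apply/pred0P => i /=; apply/negP => /andP[it iu].
    by move: ne; rewrite (BP _ _ _ it iu) eqxx.
  + apply/imsetP => -[t _ /setP e]; have [i ci] := surj t.
    by have := e i; rewrite !inE ci eqxx.
- by rewrite card_imset // cardT size_enum_ord.
- apply: eq_bigr => i _; apply: eq_bigl => j; congr andb.
  apply/eqP/existsP => [cij|[_ /andP[/imsetP[t _ ->] /andP[]]]].
    by exists (B (c i)); rewrite imset_f // !inE cij eqxx.
  by rewrite !inE => /eqP-> /eqP->.
Qed.

(** By the pigeonhole principle two of the [p] indices share a block, and their factor vanishes at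
    [a]. *)
Lemma partition_product_vanishes p (P : {set {set 'I_N.+1}}) (a : 'I_N.+1 -> K) :
  partition P [set: 'I_N.+1] -> (#|P| < p)%N -> equal_powers_locus m p a ->
  (partition_product K m P).@[a] = 0.
Proof.
move=> partP ltP [I [cardI eqI]]; have /and3P[/eqP covP trivP _] := partP.
have /dinjectivePn[i iI [j /andP[ne_ij jI] eij]] :
    ~~ dinjectiveb (pblock P) (mem I).
  apply/negP => /dinjectiveP inj; move: ltP; rewrite -cardI -(card_in_imset inj).
  rewrite ltnNge => /negP; apply; apply/subset_leq_card/subsetP.
  by move=> _ /imsetP[i _ ->]; rewrite pblock_mem // covP inE.
have blk l : l \in pblock P l by rewrite mem_pblock covP inE.
have blkP l : pblock P l \in P by rewrite pblock_mem // covP inE.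
wlog lt_ij : i j iI jI ne_ij eij / (i < j)%N.
  move=> W; case: (ltngtP i j) => [||e]; first exact: (W i j).
    by apply: (W j i) => //; rewrite eq_sym.
  by move: ne_ij; rewrite (val_inj e) eqxx.
rewrite /partition_product rmorph_prod /= (bigD1 i) //= rmorph_prod /=.
rewrite (bigD1 j) /=.
  by rewrite rmorphB !rmorphXn /= !mevalXU (eqI i j) // subrr !mul0r.
by rewrite lt_ij; apply/existsP; exists (pblock P i); rewrite blkP blk eij blk.
Qed.

End Colorings.

(** * The ideal of the equal-powers locus *)

(** For a shape with [n] boxes the condition means at most [r] nonzero rows; as a bound on a prefix
    sum it passes to dominating shapes. *)
Lemma prefix_sum_dominance_closed n r :
  dominance_closed (fun kap => (n <= prefix_sum kap r)%N).
Proof. by move=> kap kap' _ _ dom; move/leq_trans; apply. Qed.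

(** Some index has rank at least [p.-1]; together with its predecessors of equal [m]-th power it
    yields [p] indices. *)
Lemma equal_powers_locus_point_shape (K : numClosedFieldType) N m p
    (a : nat -> K) : (0 < p)%N ->
  ~ (N.+1 <= prefix_sum (point_shape m N.+1 a) p.-1)%N ->
  @equal_powers_locus K N.+1 m p (fun i : 'I_N.+1 => a i).
Proof.
move=> p_gt0 /negP; rewrite /point_shape prefix_sum_color_count -ltnNge => lt.
pose b i := a i ^+ m.
have [i /negP ri] : exists i : 'I_N.+1, ~ (rank b i < p.-1)%N.
  apply/existsNP => all_lt; move: lt; rewrite ltnNge => /negP; apply.
  rewrite -[X in (X <= _)%N]card_ord -cardsT; apply/subset_leq_card/subsetP => i _.
  by rewrite inE; exact: all_lt.
have : (p <= #|[set j : 'I_N.+1 | b j == b i]|)%N.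
  rewrite -(sum_bool_card N.+1 (fun j => b j == b i)).
  apply: leq_trans (@ltn_sum_bool (fun j => b j == b i) _ _ (ltn_ord i) (eqxx _)).
  by move: ri; rewrite -leqNgt /rank; lia.
move=> /card_geqP[s [us szs sub_s]]; exists [set j in s]; split.
  by rewrite cardsE (card_uniqP us).
move=> j l; rewrite !inE => /sub_s; rewrite inE => /eqP bj /sub_s.
by rewrite inE => /eqP bl; rewrite -/(b j) bj -bl.
Qed.

Lemma color_product_in_ideal (K : numClosedFieldType) N m r c : (r <= N.+1)%N ->
  (N.+1 <= prefix_sum (color_count N.+1 c) r)%N ->
  exists w g, partition_generator m r g /\ color_product K N m N.+1 c = w * g.
Proof.
move=> le_r; rewrite prefix_sum_color_count => full.
have c_lt (i : 'I_N.+1) : (c i < r)%N.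
  have: [set i : 'I_N.+1 | (c i < r)%N] == [set: 'I_N.+1].
    by rewrite eqEcard subsetT cardsT card_ord.
  by move=> /eqP/setP/(_ i); rewrite !inE.
pose c0 i := Ordinal (c_lt i).
have [c' [surj ref]] := refine_surjective c0 le_r.
have [w Dw] : exists w, ord_color_product K m (fun i : 'I_N.+1 => c i) =
    w * ord_color_product K m c'.
  by apply: ord_color_product_refine => i j /ref/(congr1 val).
exists w, (ord_color_product K m c'); rewrite color_productE Dw; split=> //.
exact: surjective_color_partition.
Qed.

Theorem equal_powers_ideal (K : numClosedFieldType) N m p (f : {mpoly K[N.+1]}) :
  (0 < m)%N -> (0 < p)%N -> (p <= N.+1)%N ->
  vanishing_ideal (@equal_powers_locus K N.+1 m p) f <->
  ideal_generated (@partition_generator K N.+1 m p.-1) f.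
Proof.
move=> m_gt0 p_gt0 le_pn; split=> [van|[s [Gs ->]] a Xa]; last first.
  rewrite rmorph_sum /= big_seq big1 // => cg /Gs[P [partP cardP ->]].
  rewrite rmorphM /= (partition_product_vanishes partP _ Xa) ?mulr0 //.
  by rewrite cardP prednK.
have : color_span m N.+1 (fun kap => (N.+1 <= prefix_sum kap p.-1)%N) f.
  apply: vanishing_in_color_span => //.
  - exact: prefix_sum_dominance_closed.
  - exact: in_vars_full.
  - by move=> a _ notD; exact/van/equal_powers_locus_point_shape.
elim=> [|u c g _ _ full _ [s [Gs ->]]].
  by exists [::]; rewrite big_nil.
have [|w [h [Gh Dh]]] := color_product_in_ideal K m _ full; first lia.
exists ((u * w, h) :: s); rewrite big_cons /= Dh mulrA; split=> // cg.
by rewrite inE => /orP[/eqP->|/Gs].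
Qed.

Theorem theorem1p3 (R : realType) (n m p : nat)
    (hm : (2 <= m)%N) (hp : (2 <= p)%N) (hpn : (p <= n)%N)
    (f : {mpoly R[i][n]}) :
  vanishing_ideal (@equal_powers_locus R[i] n m p) f <->
  ideal_generated (@partition_generator R[i] n m (p - 1)) f.
Proof.
case: n hpn f => [|N] hpn f; first by lia.
rewrite subn1; apply: (@equal_powers_ideal R[i]) => //; exact: ltnW.
Qed.
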